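(* There exist sets $A,A'\subset\mathbb{N}$ with $\underline{\mathrm{d}}(A)=1/2$ and $\underline{\mathrm{d}}(A')=3/4$ such that there is no infinite $B\subset\mathbb{N}$ and no number $t\in\mathbb{N}$ with $B+B+t\subset A$, and there is no infinite $B\subset\mathbb{N}$ with $B+B\subset A'$.
   Context: $\mathbb{N}=\{1,2,3,\dots\}$. For $A\subset\mathbb{N}$, the lower density is $\underline{\mathrm{d}}(A)=\liminf_{N\to\infty}\frac{|A\cap[1,N]|}{N}$, where $[1,N]=\{1,\dots,N\}$. $B+B+t=\{b_1+b_2+t : b_1,b_2\in B\}$ (the case $b_1=b_2$ is allowed), and $B+B$ is the case $t=0$. *)

(* Defs.v *)
From HB Require Import structures.
From mathcomp Require Import all_boot all_order all_algebra finmap.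
From mathcomp Require Import all_classical all_reals all_analysis.

Set Implicit Arguments.
Unset Strict Implicit.
Unset Printing Implicit Defensive.

Import Order.TTheory GRing.Theory Num.Theory.

Local Open Scope classical_set_scope.
Local Open Scope ring_scope.

(* The natural numbers start at 1: subsets of {1, 2, 3, ...} are the sets of
   type [set nat] contained in [posnat]. *)
Definition posnat : set nat := [set n | (1 <= n)%N].

(* |A `&` [1, N]| *)
Definition count_upto (A : set nat) (N : nat) : nat :=
  #|` fset_set (A `&` [set n | (1 <= n <= N)%N]) |%fset.

(* The term at N = 0 is 0 / 0 = 0; it has no influence on the liminf. *)
Definition lower_density (R : realType) (A : set nat) : \bar R :=
  limn_einf (fun N : nat => ((count_upto A N)%:R / N%:R : R)%:E).

(* B + B + t, where the two summands from B may coincide *)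
Definition sumset_shift (B : set nat) (t : nat) : set nat :=
  [set (b1 + b2 + t)%N | b1 in B & b2 in B].

Definition sumset (B : set nat) : set nat := sumset_shift B 0.

(* Main.v *)
Require Import Defs.
From HB Require Import structures.
From mathcomp Require Import all_boot all_order all_algebra finmap.
From mathcomp Require Import all_classical all_reals all_analysis.
From mathcomp Require Import zify ring lra.

Set Implicit Arguments.
Unset Strict Implicit.
Unset Printing Implicit Defensive.

Import Order.TTheory GRing.Theory Num.Theory.

Local Open Scope classical_set_scope.
Local Open Scope ring_scope.

(** The two sets come from one set S of density 1/2 such that, for every s >= 1,
only finitely many x in S have 2 x - s in S too. Such an S contains no
B + B + t with B infinite: fix b1 >= 1 in B, let b in B be large and put
x = b + b1 + t; then x and 2 x - (2 b1 + t) = b + b + t would both be in S.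

For A take S itself. For A' take the odd numbers together with 2 S, of
density 1/2 + (1/2)(1/2) = 3/4. If B + B lies in A', infinitely many elements of
B are of the form 2 c + d with one fixed d in {0, 1}; the sums of two of these
are the even numbers 2 (c1 + c2 + d), so the corresponding infinite set C
satisfies C + C + d <= S, which is impossible.

Construction of S. Let k = scale x be the integer part of log2 x, and
cut the integers into dyadic blocks of length W = width x, the power of 2 with
k W <= x < 2 k W. Let q = x / W be the number of the block of x. Then x belongs
to S when k + q is odd and x is not one of the first k elements of its block.

If the block containing 2 x - s always had length 2 W, it would have the
number q again (the removal of the first k elements absorbs a shift s <= k),
whereas the scale has grown to k + 1, so the parity test would fail at
2 x - s. This is [doubling_free_double]. The length of blocks must however tend
to 0 relative to x, since with lengths proportional to x the proportion of S in
[1, N] would oscillate; so from time to time a block is not replaced by its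
double. The rule k W <= x < 2 k W makes this happen only when q = k, one block
per scale, and then k + q = 2 k is even, so that block is outside of S anyway.

Density. As long as k and W are constant, membership is periodic of period
2 W, with W - k members in each period ([alternating_window]), and k is
small compared to W, because k^3 = O(2^k). On the scale [2^k, 2^(k+1)) only two
values of W occur, so the deviation from 1/2 is there O(2^k / k)
([doubling_free_scale]). These errors sum up geometrically to O(N / log N)
([doubling_free_count]). *)

(** * A set without solutions of y = 2 x - s *)

Local Open Scope nat_scope.

Definition scale (x : nat) := trunc_log 2 x.
Definition width (x : nat) := 2 ^ trunc_log 2 (x %/ scale x).
(** Blocks of length W are kept when their number has the parity opposite to k;
dropping the first k elements of a kept block makes room for shifts up to k. *)
Definition alternating (k W x : nat) := odd (k + x %/ W) && (k <= x %% W).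
Definition doubling_free (x : nat) := alternating (scale x) (width x) x.

Lemma scale_eq k x : 2 ^ k <= x < 2 ^ k.+1 -> scale x = k.
Proof. exact: trunc_log_eq. Qed.

Lemma scale_ge k x : 2 ^ k <= x -> k <= scale x.
Proof. exact: trunc_log_max. Qed.

Lemma scale_lt x : 0 < x -> scale x < x.
Proof. by move=> x0; apply: leq_trans (@trunc_logP 2 x isT x0); apply: ltn_expl. Qed.

Lemma width_eq k e x : scale x = k -> 0 < k ->
  k * 2 ^ e <= x < k * 2 ^ e.+1 -> width x = 2 ^ e.
Proof.
move=> <- k0 /andP[lo hi]; rewrite /width; congr (2 ^ _).
by apply: trunc_log_eq; rewrite // leq_divRL // ltn_divLR // mulnC lo mulnC.
Qed.

Lemma width_bounds x : 0 < scale x -> scale x * width x <= x < scale x * (2 * width x).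
Proof.
move=> k0.
have q0 : 0 < x %/ scale x.
  rewrite divn_gt0 //; apply: (leq_trans (ltnW (ltn_expl (scale x) (isT : 1 < 2)))).
  by apply: trunc_logP => //; case: x k0 => //; rewrite /scale trunc_log0.
have /andP[lo hi] := @trunc_log_bounds 2 _ isT q0.
by rewrite -expnS mulnC -leq_divRL // lo mulnC -ltn_divLR.
Qed.

(** The quotient q = x %/ W is at least k, and the parity test excludes q = k.
For q > k the number 2 x - s lies in the block of length 2 W numbered q, at
scale k + 1, so its parity test gives the opposite answer. *)
Lemma doubling_free_double x s : 0 < s <= scale x ->
  doubling_free x -> ~~ doubling_free (2 * x - s).
Proof.
move=> /andP[s0 sk] /andP[par rem].
have k0 : 0 < scale x by apply: leq_trans sk.
have /andP[lo hi] := width_bounds k0.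
have x0 : 0 < x by case: (x) k0 => //; rewrite /scale trunc_log0.
have /andP[klo khi] := @trunc_log_bounds 2 _ isT x0.
set e := trunc_log 2 (x %/ scale x).
have We : width x = 2 ^ e by [].
rewrite -/(scale x) in klo khi.
move: par rem lo hi klo khi sk k0.
move Ek : (scale x) => k; move EW : (width x) => W; move=> par rem lo hi klo khi sk k0.
rewrite EW in We.
have W0 : 0 < W by rewrite We expn_gt0.
have xE := divn_eq x W; have rW := ltn_pmod x W0.
move: par rem xE rW; set q := x %/ W; set r := x %% W => par rem xE rW.
(* This is where the blocks that do not double are avoided. *)
have kq : k < q.
  have : k <= q by rewrite /q leq_divRL.
  by rewrite leq_eqVlt => /orP[/eqP kq|//]; rewrite -kq addnn odd_double in par.
(* W divides 2 ^ k, hence no block straddles two scales: the whole block of x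
   lies above 2 ^ k, and going down by s after doubling does not leave its
   image. *)
have ek : 2 ^ k <= q * W.
  have dv : W %| 2 ^ k.
    rewrite We dvdn_Pexp2l //.
    have : 2 ^ e < 2 ^ k.+1 by rewrite -We; apply: leq_ltn_trans khi; nia.
    by rewrite ltn_exp2l.
  by rewrite -(divnK dv) leq_mul2r leq_div2r ?orbT.
have zlo : q * (2 * W) <= 2 * x - s by nia.
have zhi : 2 * x - s < q.+1 * (2 * W) by nia.
have Ez : scale (2 * x - s) = k.+1.
  by apply: scale_eq; rewrite !expnS in khi *; apply/andP; split; lia.
have EWz : width (2 * x - s) = 2 * W.
  rewrite We -expnS; apply: (width_eq Ez) => //.
  by rewrite !expnS -We; apply/andP; split; nia.
have Eq : (2 * x - s) %/ (2 * W) = q.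
  apply/eqP; rewrite eqn_leq leq_divRL ?muln_gt0 ?W0 // zlo andbT.
  by rewrite -ltnS ltn_divLR ?muln_gt0 ?W0.
by rewrite /doubling_free /alternating Ez EWz Eq addSn oddS par.
Qed.

(** * Counting in windows *)

Definition window (f : nat -> nat) (a n : nat) := \sum_(i < n) f (a + i).

Lemma window_cat f a m n : window f a (m + n) = window f a m + window f (a + m) n.
Proof.
rewrite /window big_split_ord /=; congr (_ + _).
by apply: eq_bigr => i _; rewrite addnA.
Qed.

Lemma eq_window f g a n : (forall x, a <= x < a + n -> f x = g x) ->
  window f a n = window g a n.
Proof. by move=> fg; apply: eq_bigr => i _; rewrite fg ?leq_addr ?ltn_add2l /=. Qed.

Lemma window_bool (P : pred nat) a n : window P a n <= n.
Proof.
by rewrite -[leqRHS]card_ord -sum1_card; apply: leq_sum => i _; apply: leq_b1.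
Qed.

Lemma window_periodic (W : nat) f a :
  (forall x, f (x + W) = f x) -> window f a W = window f 0 W.
Proof.
move=> per; elim: a => [//|a <-].
have h := window_cat f a 1 W; rewrite addnC window_cat in h.
move: h; rewrite /window !big_ord1 !addn0 per addn1; lia.
Qed.

(** Moving by W changes the parity of the block number and nothing else, so exactly
one of x and x + W passes the parity test. *)
Lemma alternating_window k W a : 0 < W -> window (alternating k W) a (2 * W) = W - k.
Proof.
move=> W0.
have -> : window (alternating k W) a (2 * W) = window (fun x => k <= x %% W) a W.
  rewrite mul2n -addnn window_cat /window -big_split /=; apply: eq_bigr => i _.
  rewrite /alternating (addnAC a W i) (divnDr (a + i) (dvdnn W)) divnn W0 modnDr addnA addn1 oddS.
  by case: (odd _); case: (k <= _).
rewrite window_periodic; last by move=> x; rewrite modnDr.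
rewrite /window (eq_bigr (fun i : 'I_W => (k <= i : nat))); last first.
  by move=> i _; rewrite add0n modn_small.
elim: (W) => [|n IH]; first by rewrite big_ord0.
rewrite big_ord_recr //= IH; case: leqP; lia.
Qed.

(** Cubing [k %/ 3 < 2 ^ (k %/ 3)] gives a bound with a constant valid for
every k, so that no scale needs a separate treatment in what follows. *)
Lemma cube_le_expn k : k ^ 3 <= 27 * 2 ^ k.
Proof.
have q3 := ltn_expl (k %/ 3) (isT : 1 < 2).
have h : 2 ^ (k %/ 3 * 3) <= 2 ^ k by rewrite leq_exp2l // leq_divM.
apply: leq_trans (leq_mul (leqnn 27) h).
rewrite expnM -[27]/(3 ^ 3) -expnMn leq_exp2r //.
by rewrite [leqLHS](divn_eq k 3); have := ltn_pmod k (isT : 0 < 3); lia.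
Qed.

(** * The density of the doubling-free set *)

Definition within (E a b : nat) := (a <= b + E) && (b <= a + E).

Lemma withinD E F a b c d : within E a b -> within F c d ->
  within (E + F) (a + c) (b + d).
Proof. rewrite /within; lia. Qed.

(** The two bounds say that k W is comparable to 2 ^ k. Each period loses
k of its W members, a proportion k / W = O(1 / k): this gives the term 54 n.
An incomplete period has length at most 2 W = O(2 ^ k / k): this gives the other
term. *)
Lemma alternating_interval k W a n : 0 < k -> 2 ^ k <= 2 * (k * W) -> k * W <= 2 * 2 ^ k ->
  within (54 * n + 4 * 2 ^ k) (k * (2 * window (alternating k W) a n)) (k * n).
Proof.
move=> k0 loW hiW.
have W0 : 0 < W by have := expn_gt0 2 k; case: W loW {hiW} => // ; lia.
have kk : k * k <= 54 * W.
  have := cube_le_expn k; rewrite !expnS expn0 muln1 => h.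
  by rewrite -(leq_pmul2l k0); lia.
have [p [r [-> r2]]] : exists p r, n = p * (2 * W) + r /\ r < 2 * W.
  by exists (n %/ (2 * W)), (n %% (2 * W)); rewrite -divn_eq ltn_pmod // muln_gt0.
have -> : window (alternating k W) a (p * (2 * W) + r) =
    p * (W - k) + window (alternating k W) (a + p * (2 * W)) r.
  elim: p a => [|p IH] a; first by rewrite !mul0n !addn0 !add0n.
  by rewrite mulSn -addnA window_cat alternating_window // IH mulSn !addnA.
have := window_bool (alternating k W) (a + p * (2 * W)) r.
move: (window _ _ _) => c cr.
have h1 : W <= W - k + k by lia.
rewrite /within; apply/andP; split.
  have : k * (2 * (p * (W - k) + c)) <= k * (2 * (p * W + r)).
    by rewrite leq_mul2l leq_mul2l leq_add ?leq_mul2l ?leq_subr ?orbT.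
  have : k * r <= k * (2 * W) by rewrite leq_mul2l ltnW ?orbT.
  lia.
have : p * (k * W) <= p * (k * (W - k) + k * k).
  by rewrite leq_mul2l -mulnDr leq_mul2l h1 !orbT.
have : p * (k * k) <= p * (54 * W) by rewrite leq_mul2l kk orbT.
have : k * r <= k * (2 * W) by rewrite leq_mul2l ltnW ?orbT.
lia.
Qed.

(** Inside a scale the width changes at most once, when x passes k 2 ^ (e + 1). *)
Lemma doubling_free_scale k n : 0 < k -> n <= 2 ^ k ->
  within (62 * 2 ^ k) (k * (2 * window doubling_free (2 ^ k) n)) (k * n).
Proof.
move=> k0 nk.
have q0 : 0 < 2 ^ k %/ k by rewrite divn_gt0 // ltnW // ltn_expl.
have /andP[lo hi] := @trunc_log_bounds 2 _ isT q0.
set e := trunc_log 2 (2 ^ k %/ k) in lo hi.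
rewrite leq_divRL // mulnC in lo; rewrite ltn_divLR // mulnC in hi.
have doubling_freeE f a m : k * 2 ^ f <= a -> a + m <= k * 2 ^ f.+1 -> 2 ^ k <= a ->
    a + m <= 2 ^ k.+1 -> window doubling_free a m = window (alternating k (2 ^ f)) a m.
  move=> h1 h2 h3 h4; apply: eq_window => x /andP[xa xm].
  have kx : scale x = k by apply: scale_eq; rewrite (leq_trans h3) // (leq_trans xm).
  by rewrite /doubling_free kx (width_eq kx k0 (e := f)) // (leq_trans h1) // (leq_trans xm).
have h2k : 2 ^ k.+1 = 2 ^ k + 2 ^ k by rewrite expnS mul2n addnn.
(* Truncated subtraction is harmless: by hi the point where the width changes
   is above 2 ^ k. *)
pose m := minn n (k * 2 ^ e.+1 - 2 ^ k).
have -> : n = m + (n - m) by rewrite subnKC // geq_minl.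
have mp : 2 ^ k + m <= k * 2 ^ e.+1 by lia.
have mn : m <= n by rewrite geq_minl.
have Ee : k * 2 ^ e.+2 = 2 * (k * 2 ^ e.+1) by rewrite !expnS; lia.
have Ee1 : k * 2 ^ e.+1 = 2 * (k * 2 ^ e) by rewrite !expnS; lia.
rewrite window_cat (@doubling_freeE e) //; [|lia].
have -> : window doubling_free (2 ^ k + m) (n - m) =
    window (alternating k (2 ^ e.+1)) (2 ^ k + m) (n - m).
  have [nm|] := leqP n m; first by rewrite (eqP nm) /window !big_ord0.
  by rewrite /m => ?; apply: doubling_freeE; lia.
have := withinD (@alternating_interval k (2 ^ e) (2 ^ k) m k0 _ _)
                (@alternating_interval k (2 ^ e.+1) (2 ^ k + m) (n - m) k0 _ _).
rewrite /within => /(_ _ _ _ _) h.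
have {}h := h ltac:(lia) ltac:(lia) ltac:(lia) ltac:(lia).
lia.
Qed.

(** Passing from the weight k to the weight k + 1 multiplies the error by
(k + 1) / k, which is at most 3 / 2 for k > 1. *)
Lemma within_succ E F k a b : 1 < k -> 3 * F <= 2 * E ->
  within F (k * a) (k * b) -> within E (k.+1 * a) (k.+1 * b).
Proof.
move=> k1 FE.
have aux x : k * x <= F -> k.+1 * x <= E.
  by have := leq_mul k1 (leqnn x); rewrite mulSn; lia.
rewrite /within => /andP[]; have [ab|/ltnW ab] := leqP a b.
  by have := aux (b - a); rewrite -(subnK ab) !mulnDr addnK; lia.
by have := aux (a - b); rewrite -(subnK ab) !mulnDr addnK; lia.
Qed.

(** The number of terms doubles from one scale to the next, while the weight k of
the estimate grows by a factor at most 3 / 2. A bound C 2 ^ k therefore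
propagates as soon as (3 / 2) (C + 62) <= 2 C, which gives C = 186 = 3 * 62. *)
Lemma doubling_free_pow k : 0 < k ->
  within (186 * 2 ^ k) (k * (2 * window doubling_free 0 (2 ^ k))) (k * 2 ^ k).
Proof.
elim: k => [//|[|[|k]] IH] _.
- by have := window_bool doubling_free 0 (2 ^ 1); rewrite /within; lia.
- by have := window_bool doubling_free 0 (2 ^ 2); rewrite /within; lia.
apply: (@within_succ _ (248 * 2 ^ k.+2)) => //; first by rewrite !expnS; lia.
have := withinD (IH isT) (@doubling_free_scale k.+2 (2 ^ k.+2) isT (leqnn _)).
have -> : 2 ^ k.+3 = 2 ^ k.+2 + 2 ^ k.+2 by rewrite expnS mul2n addnn.
rewrite window_cat add0n /within; move: (2 ^ k.+2) (window _ _ _) (window _ _ _); lia.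
Qed.

Lemma doubling_free_count N : 0 < N ->
  within (248 * N) (scale N * (2 * window doubling_free 0 N)) (scale N * N).
Proof.
move=> N0; have := @trunc_log_bounds 2 _ isT N0; rewrite /= -/(scale N).
case: (posnP (scale N)) => [->|k0]; first by rewrite /within; lia.
move: (scale N) k0 => k k0; rewrite expnS => /andP[lo hi].
have mk : N - 2 ^ k <= 2 ^ k by lia.
have := withinD (doubling_free_pow k0) (doubling_free_scale k0 mk).
move: {lo hi mk} (N - 2 ^ k) (subnKC lo) => m <-.
rewrite window_cat add0n /within.
move: (2 ^ k) (window _ _ _) (window _ _ _); lia.
Qed.

(** * Adjoining the odd numbers *)

Definition odd_or_double (P : pred nat) : pred nat := fun n => odd n || P (n./2)%N.

Lemma window_odd_or_double (P : pred nat) M :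
  window (odd_or_double P) 0 M.*2 = (M + window P 0 M)%N.
Proof.
elim: M => [|M IH]; first by rewrite /window !big_ord0.
rewrite doubleS -addn2 window_cat IH -[in RHS]addn1 window_cat.
rewrite /window !big_ord_recl !big_ord0 /= /odd_or_double /bump /=.
rewrite !add0n !addn0 addn1 /= odd_double uphalf_double /= doubleK.
case: (P M) => /=; lia.
Qed.

(** For N > 1, N and the half of N differ by one in scale, so the estimate for the
doubling-free set at N / 2 transfers at the cost of a larger constant. *)
Lemma odd_or_double_count N : (0 < N)%N ->
  within (260 * N) (scale N * (4 * window (odd_or_double doubling_free) 0 N))
    (scale N * (3 * N)).
Proof.
case: N => [//|[_|N _]]; first by rewrite /scale trunc_log1.
set n := N.+2; have n1 : (1 < n)%N by [].
have M0 : (0 < n./2)%N by rewrite half_gt0.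
have kM : (scale n./2 < n./2)%N := scale_lt M0.
have cM := window_bool doubling_free 0 n./2.
have := doubling_free_count M0; rewrite /scale (trunc_log2S n1) -!/(scale _).
have := odd_double_half n; move: (n) (n./2) (scale _) kM cM => m M k kM cM mE h.
have [d [wd ->]] : exists d, (d <= 1)%N /\
    window (odd_or_double doubling_free) 0 m = (M + window doubling_free 0 M + d)%N.
  exists (window (odd_or_double doubling_free) M.*2 (odd m)).
  split; first by apply: leq_trans (window_bool _ _ _) _; case: odd.
  by rewrite -[in LHS]mE addnC window_cat window_odd_or_double.
move: mE h cM; rewrite /within; move: (window _ _ _) => c mE h cM.
have oe : (odd m <= 1)%N by case: odd.
move: (odd m : nat) mE oe => o mE oe.
have kd : (k.+1 * d <= k.+1)%N by nia.
have ko : (k.+1 * o <= k.+1)%N by nia.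
have mE' : (k * m = k * o + 2 * (k * M))%N by rewrite -mE -addnn; lia.
lia.
Qed.

Local Close Scope nat_scope.

(** * From counting estimates to lower densities *)

Lemma count_upto_window (P : pred nat) N : P 0%N = false ->
  count_upto [set n | P n] N = window P 0 N.+1.
Proof.
move=> P0; rewrite /count_upto.
have -> : fset_set ([set n | P n] `&` [set n | (1 <= n <= N)%N]) =
          [fset n in [seq n <- iota 1 N | P n]]%fset.
  apply/fsetP => x; rewrite in_fset_set; last first.
    by apply: (@sub_finite_set _ _ `I_N.+1) => // y /= [_ /andP[]].
  rewrite !inE /= mem_filter mem_iota add1n ltnS.
  by apply/idP/idP => [/set_mem[/= -> ->]|/andP[Px xN]]; rewrite ?inE.
rewrite card_fseq undup_id ?filter_uniq ?iota_uniq // size_filter -sum1_count.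
rewrite /window big_ord_recl /= P0 add0n big_mkcond.
rewrite -[X in iota _ X]subn0 -/(index_iota _ _).
rewrite (_ : iota 1 (N - 0) = index_iota 1 N.+1); last by rewrite /index_iota subSS.
rewrite big_add1 big_mkord; apply: eq_bigr => i _.
by rewrite /bump /= add0n add1n; case: (P _).
Qed.

(** A counting error O(N / log N) makes the quotients converge, so that the lower
density is an actual limit. *)
Lemma lower_density_window (R : realType) (P : pred nat) (p q C : nat) :
  P 0%N = false -> (0 < q)%N ->
  (forall N, (0 < N)%N ->
    within (C * N) (scale N * (q * window P 0 N)) (scale N * (p * N))) ->
  lower_density R [set n | P n] = (p%:R / q%:R)%:E.
Proof.
move=> P0 q0 err; apply: (cvg_limn_einf_sup _).1; apply: cvg_EFin.
  by apply: nearW.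
apply/cvgrPdist_le => e e0 /=.
near=> N.
have : (2 ^ (Num.truncn ((C + q)%:R / e)).+1 <= N)%N by near: N; exact: nbhs_infty_ge.
move=> NK; have N0 : (0 < N)%N by apply: leq_trans NK; rewrite expn_gt0.
have := scale_ge NK; set k := scale N => kge.
have k0 : (0 < k)%N by lia.
have eR : (C + q)%:R <= e * k%:R :> R.
  rewrite mulrC -ler_pdivrMr //; apply: ltW; apply: lt_le_trans (truncnS_gt _) _.
  by rewrite ler_nat.
rewrite count_upto_window //.
have kN : (k <= N)%N := ltnW (scale_lt N0).
have {}err : within ((C + q) * N) (k * (q * window P 0 N.+1)) (k * (p * N)).
  (* [count_upto] counts up to N inclusive: the additional element costs at
     most q k <= q N. *)
  have := err _ N0; rewrite -[(N.+1)%N]addn1 window_cat.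
  have : (window P (0 + N) 1 <= 1)%N by exact: window_bool.
  move: (window P _ 1) => d d1; rewrite -/k /within.
  have : (k * (q * d) <= q * N)%N by rewrite mulnCA leq_mul2l -[leqRHS]muln1 leq_mul ?orbT.
  lia.
move: (window P 0 N.+1) err => c /andP[e1 e2].
have NR : 0 < N%:R :> R by rewrite ltr0n.
have kR : 0 < k%:R :> R by rewrite ltr0n.
have qR : 0 < q%:R :> R by rewrite ltr0n.
have q1 : 1 <= q%:R :> R by rewrite ler1n.
have pos : 0 < k%:R * q%:R * N%:R :> R by rewrite !mulr_gt0.
move: e1 e2; rewrite -!(ler_nat R) !natrD !natrM natrD => e1 e2.
have bnd : (C%:R + q%:R) * N%:R <= e * (k%:R * q%:R * N%:R) :> R.
  rewrite natrD in eR; rewrite !mulrA ler_pM2r //.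
  by apply: (le_trans eR); rewrite ler_peMr // mulr_ge0 // ltW.
rewrite -(ler_pM2r pos) -{1}(gtr0_norm pos) -normrM.
have -> : (p%:R / q%:R - c%:R / N%:R) * (k%:R * q%:R * N%:R) =
  k%:R * (p%:R * N%:R) - k%:R * (q%:R * c%:R) :> R by field; rewrite !gt_eqF.
rewrite ler_norml; apply/andP; split; lra.
Unshelve. all: by end_near. Qed.

(** * Infinite sumsets *)

Lemma infinite_unbounded (B : set nat) n : infinite_set B -> exists2 b, B b & (n <= b)%N.
Proof.
move=> infB; apply: contrapT => h; apply: infB.
apply: (@sub_finite_set _ _ `I_n) => // b Bb /=.
by rewrite ltnNge; apply/negP => nb; apply: h; exists b.
Qed.

Lemma doubling_free_no_sumset (B : set nat) t : infinite_set B ->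
  ~ (forall b1 b2, B b1 -> B b2 -> doubling_free (b1 + b2 + t)).
Proof.
move=> infB sub.
have [b1 Bb1 b1_gt0] := infinite_unbounded 1 infB.
have [b Bb bge] := infinite_unbounded (2 ^ (2 * b1 + t)) infB.
have kge : (0 < 2 * b1 + t <= scale (b + b1 + t))%N.
  by rewrite scale_ge ?andbT; lia.
have := doubling_free_double kge (sub _ _ Bb Bb1).
rewrite (_ : (_ - _)%N = (b + b + t)%N); last lia.
by rewrite sub.
Qed.

(** Sums of two elements of the same parity are even, so they must come from the
doubles. The parity d of the elements becomes the shift t = d for the set of their
halves. *)
Lemma odd_or_double_no_sumset (B : set nat) : infinite_set B ->
  ~ (forall b1 b2, B b1 -> B b2 -> odd_or_double doubling_free (b1 + b2)%N).
Proof.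
move=> infB sub.
have noC (d : bool) : finite_set [set c | B (c.*2 + d)%N].
  apply: contrapT => infC; apply: (doubling_free_no_sumset (t := d) infC) => c1 c2 /= h1 h2.
  have := sub _ _ h1 h2; rewrite /odd_or_double.
  have -> : (c1.*2 + d + (c2.*2 + d))%N = ((c1 + c2 + d).*2)%N.
    by rewrite addnACA addnn -!doubleD.
  by rewrite odd_double doubleK.
apply: infB; pose f (d : bool) (c : nat) := (c.*2 + d)%N.
apply: (@sub_finite_set _ _ (f false @` [set c | B (c.*2 + false)%N] `|`
                             f true @` [set c | B (c.*2 + true)%N])); last first.
  by rewrite finite_setU; split; apply: finite_image.
move=> b Bb; have bE : b = f (odd b) (b./2)%N by rewrite /f addnC odd_double_half.
have Bf : B (f (odd b) (b./2)%N) by rewrite -bE.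
by case: (odd b) bE Bf => bE Bf; [right|left]; exists (b./2)%N.
Qed.

Theorem proposition4p2 (R : realType) :
  exists A A' : set nat,
    [/\ A `<=` posnat /\ A' `<=` posnat,
        lower_density R A = (1 / 2)%:E,
        lower_density R A' = (3 / 4)%:E,
        ~ (exists (B : set nat) (t : nat),
             [/\ B `<=` posnat, infinite_set B, posnat t &
                 sumset_shift B t `<=` A]) &
        ~ (exists B : set nat,
             [/\ B `<=` posnat, infinite_set B & sumset B `<=` A'])].
Proof.
have s0 : doubling_free 0 = false.
  by rewrite /doubling_free /alternating /scale trunc_log0 div0n.
exists [set n | doubling_free n], [set n | odd_or_double doubling_free n]; split.
- by split=> -[]; rewrite //= ?/odd_or_double /= s0.
- apply: (@lower_density_window R doubling_free 1 2 248) => // N N0.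
  by rewrite mul1n doubling_free_count.
- apply: (@lower_density_window R (odd_or_double doubling_free) 3 4 260) => //.
  exact: odd_or_double_count.
- move=> [B [t [_ infB _ sub]]]; apply: (doubling_free_no_sumset (t := t) infB).
  by move=> b1 b2 h1 h2; apply: sub; exists b1 => //; exists b2.
- move=> [B [_ infB sub]]; apply: (odd_or_double_no_sumset infB).
  by move=> b1 b2 h1 h2; apply: sub; exists b1 => //; exists b2; rewrite // addn0.
Qed.
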